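(* Let $A$ be an attackable visible slot of class $\tau$ chosen by the adversary, possibly as a function of the server's view. Suppose that, conditioned on the server's view and on the declared leakage profile, the client's randomization maps $A$ to a verifier location with probability $q_v^{(\tau)}\in[0,1]$. Suppose further that any attack landing on a verifier location of class $\tau$ is detected by the classical verifier check with probability at least $\delta_\tau\in[0,1]$. Then the single-attack non-detection probability satisfies $$p_{\mathrm{nd}}^{(1)}(\tau)\le 1-\delta_\tau\, q_v^{(\tau)} .$$ In particular, in the homogeneous uniform case, in which all attackable locations are indistinguishable to the server and the randomization is uniform over $L_d$ data locations and $L_v$ verifier locations (with $L_d+L_v>0$) and verifier hits are detected with probability at least $\delta$, one may take $q_v=\dfrac{L_v}{L_d+L_v}$, which gives $$p_{\mathrm{nd}}\le 1-\delta\,\frac{L_v}{L_d+L_v}.$$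
   Context: Setting: a client delegates a compiled quantum execution to a server. The execution contains data locations and hidden verifier (trap) locations whose correct classical outcomes the client can check; the placement is randomized secretly by the client. The server-visible attackable slots are partitioned into visible operation classes $\tau$ according to features the server can observe. With $L_v^{(\tau)}$ the number of verifier slots of class $\tau$ and $L_{\mathrm{tot}}^{(\tau)}>0$ the total number of slots of class $\tau$, one sets $q_v^{(\tau)}=L_v^{(\tau)}/L_{\mathrm{tot}}^{(\tau)}$. The non-detection probability $p_{\mathrm{nd}}^{(1)}(\tau)$ is the probability that an attack on the single slot $A$ is not detected by the verifier check. The declared leakage profile is the information the protocol allows the server to learn. *)

(* Defs.v *)
From HB Require Import structures.
From mathcomp Require Import all_boot all_order all_algebra.
From mathcomp Require Import all_classical all_reals all_analysis.

Set Implicit Arguments.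
Unset Strict Implicit.
Unset Printing Implicit Defensive.

Import Order.TTheory GRing.Theory Num.Theory.

Local Open Scope classical_set_scope.
Local Open Scope ring_scope.

Section Conditional.
Context {R : realType} {d d' : measure_display}.
Context {Om : measurableType d} {T : measurableType d'}.
Variable P : probability Om R.

(* Kolmogorov's definition: [f] is a version of x |-> P(E | X = x), i.e.
   [f \o X] is a version of the conditional probability of [E] given the
   sigma-algebra generated by [X]. *)
Definition cond_prob_given (X : Om -> T) (E : set Om) (f : T -> R) : Prop :=
  measurable_fun setT f /\
  forall B : set T, measurable B ->
    P (E `&` X @^-1` B) = (\int[P]_(w in X @^-1` B) (f (X w))%:E)%E.

(* P(E | F); equal to 0 by convention when P(F) = 0. *)
Definition cond_prob (E F : set Om) : R := fine (P (E `&` F)) / fine (P F).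

End Conditional.

(* All randomness (the client's secret placement, the server's view, the
   declared leakage, the outcomes of the run) lives on one probability space
   (Om, P).  The server addresses visible slots; the client's secret placement
   puts the underlying (data or verifier) locations into these slots. *)
Record execution (R : realType) (d dV dW : measure_display)
    (Om : measurableType d) (P : probability Om R)
    (V : measurableType dV) (W : measurableType dW)
    (slot loc : finType) (class : eqType) (Op : Type) := Execution {
  slot_class : slot -> class;
  is_verifier : {pred loc};
  placement : Om -> slot -> loc;
  placement_bij : forall w, bijective (placement w);
  placement_meas : forall s l, measurable [set w | placement w s = l];
  (* The placement is random, but the number of verifier slots in each visible
     class is not. *)
  L_v : class -> nat;
  L_vE : forall w t,
    #|[set s | slot_class s == t & is_verifier (placement w s)]%SET| = L_v t;
  view : Om -> V;
  view_meas : measurable_fun setT view;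
  leakage : Om -> W;
  leakage_meas : measurable_fun setT leakage;
  (* [rejects s o]: the client's classical verifier check fails when the single
     attack operation [o] is applied at slot [s]. *)
  rejects : slot -> Op -> set Om
}.

(* A single-slot attack: both the attacked slot and the operation applied to it
   may depend on the server's view. *)
Record attack (R : realType) (d dV dW : measure_display)
    (Om : measurableType d) (P : probability Om R)
    (V : measurableType dV) (W : measurableType dW)
    (slot loc : finType) (class : eqType) (Op : Type)
    (X : execution P V W slot loc class Op) := Attack {
  target : V -> slot;
  target_meas : forall s, measurable (target @^-1` [set s]);
  operation : V -> Op;
  attack_rejects_meas :
    measurable [set w | rejects X (target (view X w)) (operation (view X w)) w]
}.

Section Execution.
Context {R : realType} {d dV dW : measure_display}.
Context {Om : measurableType d} {P : probability Om R}.
Context {V : measurableType dV} {W : measurableType dW}.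
Context {slot loc : finType} {class : eqType} {Op : Type}.
Variable X : execution P V W slot loc class Op.

Definition L_tot (t : class) : nat := #|[set s | slot_class X s == t]%SET|.

Definition q_v (t : class) : R := (L_v X t)%:R / (L_tot t)%:R.

Definition n_verifier : nat := #|[set l | is_verifier X l]%SET|.
Definition n_data : nat := #|[set l | ~~ is_verifier X l]%SET|.

Definition server_info (w : Om) : V * W := (view X w, leakage X w).

Definition attacks_class (A : attack X) (t : class) : Prop :=
  forall v, slot_class X (target A v) = t.

Definition hits_verifier (A : attack X) : set Om :=
  [set w | is_verifier X (placement X w (target A (view X w)))].

Definition detected (A : attack X) : set Om :=
  [set w | rejects X (target A (view X w)) (operation A (view X w)) w].

Definition p_nd (A : attack X) : R := fine (P (~` detected A)).

Definition verifier_hits_detected (t : class) (delta : R) : Prop :=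
  forall B : attack X, attacks_class B t -> (0 < P (hits_verifier B))%E ->
    delta <= cond_prob P (detected B) (hits_verifier B).

Definition uniform_placement : Prop :=
  forall (s : slot) (l : loc),
    cond_prob_given P server_info [set w | placement X w s = l]
      (cst ((n_data + n_verifier)%:R^-1)).

Lemma q_v_itv (t : class) : 0 <= q_v t <= 1.
Proof.
have le_vt : (L_v X t <= L_tot t)%N.
  have [w _] : [set: Om] !=set0.
    apply/set0P/eqP => Om0; have := probability_setT P.
    by rewrite Om0 measure0 => /esym/eqP; rewrite onee_eq0.
  rewrite -(L_vE X w) /L_tot; apply/subset_leq_card/fintype.subsetP => s.
  by rewrite !inE => /andP[].
rewrite /q_v divr_ge0 ?ler0n//=.
case: (posnP (L_tot t)) => [->|t_gt0]; first by rewrite invr0 mulr0 ler01.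
by rewrite ler_pdivrMr ?ltr0n// mul1r ler_nat.
Qed.

End Execution.

(* Main.v *)
(* Testing the conditional probability on the whole space shows that the attack
   hits a verifier location with probability q_v; when q_v > 0, the detection
   probability is at least P(detected and hit) >= delta * q_v, and when q_v = 0
   there is nothing to prove.  In the uniform case, for a fixed slot the
   conditional probability of holding a verifier location is the sum over the
   n_verifier locations of 1 / (n_data + n_verifier); this value does not depend
   on the slot, so it is unchanged when the slot is picked from the view. *)

Require Import Defs.
From HB Require Import structures.
From mathcomp Require Import all_boot all_order all_algebra.
From mathcomp Require Import all_classical all_reals all_analysis.

Set Implicit Arguments.
Unset Strict Implicit.
Unset Printing Implicit Defensive.

Import Order.TTheory GRing.Theory Num.Theory.

Local Open Scope classical_set_scope.
Local Open Scope ring_scope.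

(** Total mass one rules out an empty space. This supplies a sample point at which the random
    placement can be evaluated in the counting lemmas. *)
Lemma probability_nonempty (R : realType) (d : measure_display)
    (T : measurableType d) (P : probability T R) : [set: T] !=set0.
Proof.
apply/set0P/eqP => T0; have := probability_setT P.
by rewrite T0 measure0 => /esym/eqP; rewrite onee_eq0.
Qed.

Lemma measure_fin_partition (R : realType) (d : measure_display)
    (T : measurableType d) (mu : {measure set T -> \bar R}) (I : finType)
    (f : T -> I) (E : set T) :
  (forall i, measurable (f @^-1` [set i])) -> measurable E ->
  mu E = (\sum_i mu (E `&` f @^-1` [set i]))%E.
Proof.
move=> mf mE.
have {1}-> : E = \bigcup_(i in [set: I]) (E `&` f @^-1` [set i]).
  by rewrite -setI_bigcupr -preimage_bigcup bigcup_imset1 image_id setIT.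
rewrite measure_fin_bigcup; last 3 first.
- exact: finite_finset.
- by move=> i j _ _ [w [[_ /= <-] [_ /= <-]]].
- by move=> i _; exact: measurableI.
(* Additivity has produced a finitely supported sum over [[set: I]]; the ordinary sum over [I] is
   brought to that form through [enum I]. *)
rewrite -big_enum [RHS]fsbig_seq ?enum_uniq//=.
rewrite [in RHS](_ : [set` _] = [set: I])//.
by apply/seteqP; split=> // i _ /=; rewrite mem_enum.
Qed.

Section ConditionalProbability.
Context {R : realType} {d d' : measure_display}.
Context {Om : measurableType d} {T : measurableType d'}.
Variables (P : probability Om R) (X : Om -> T).
Hypothesis mX : measurable_fun setT X.

Lemma measurable_preimage (B : set T) : measurable B -> measurable (X @^-1` B).
Proof. by move=> mB; rewrite -[_ @^-1` _]setTI; exact: mX. Qed.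

(** The integral of a constant is a multiple of the measure, so Kolmogorov's condition becomes a
    product rule and later arguments need no integral. *)
Lemma cond_prob_given_cstP (E : set Om) (c : R) :
  cond_prob_given P X E (cst c) <->
  forall B, measurable B -> P (E `&` X @^-1` B) = (c%:E * P (X @^-1` B))%E.
Proof.
split=> [[_ PE] B mB|PE].
  by rewrite PE// -integral_cst//; exact: measurable_preimage.
split=> [|B mB]; first exact: measurable_cst.
by rewrite PE// -integral_cst//; exact: measurable_preimage.
Qed.

Lemma cond_prob_given_cstT (E : set Om) (c : R) :
  cond_prob_given P X E (cst c) -> P E = c%:E.
Proof.
move=> /cond_prob_given_cstP/(_ _ measurableT).
by rewrite preimage_setT setIT probability_setT mule1.
Qed.

(** Split along the fibres of [f]: those outside [A] miss the event, and each of the [#|A|] others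
    contributes the same amount. *)
Lemma cond_prob_given_fin_uniform (I : finType) (f : Om -> I) (p : R)
    (A : {pred I}) :
  (forall i, measurable (f @^-1` [set i])) ->
  (forall i, cond_prob_given P X (f @^-1` [set i]) (cst p)) ->
  cond_prob_given P X [set w | f w \in A] (cst (#|A|%:R * p)).
Proof.
move=> mf fp; apply/cond_prob_given_cstP => B mB.
have mXB := measurable_preimage mB.
have mA : measurable [set w | f w \in A].
  have -> : [set w | f w \in A] = \bigcup_(i in [set` A]) f @^-1` [set i].
    by rewrite -preimage_bigcup bigcup_imset1 image_id.
  exact: fin_bigcup_measurable.
rewrite (measure_fin_partition P mf (measurableI _ _ mA mXB)).
rewrite (bigID (mem A))/= [X in (_ + X)%E]big1 ?adde0; last first.
  move=> i iNA; rewrite (_ : _ `&` _ = set0) ?measure0//.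
  by apply/seteqP; split=> // w [[/= wA _] wi]; rewrite wi (negPf iNA) in wA.
transitivity (\sum_(i in A) (p%:E * P (X @^-1` B)))%E.
  apply: eq_bigr => i iA.
  have /cond_prob_given_cstP/(_ _ mB) <- := fp i.
  congr (P _); apply/seteqP; split=> [w [[_ Xw] fw]//|w [fw Xw]].
  by split=> //; split=> //=; rewrite fw.
have /fineK <- := fin_num_measure P _ mXB.
by rewrite -EFinM sumEFin sumr_const -[_ * _ *+ _]mulr_natl mulrA EFinM.
Qed.

(* If each event [E i] has conditional probability [c] whatever [X] reveals,
   choosing [i] as a function of [X] gains nothing: condition on the choice. *)
Lemma cond_prob_given_at_choice (I : finType) (g : T -> I) (E : I -> set Om)
    (c : R) :
  (forall i, measurable (g @^-1` [set i])) -> (forall i, measurable (E i)) ->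
  (forall i, cond_prob_given P X (E i) (cst c)) ->
  cond_prob_given P X [set w | E (g (X w)) w] (cst c).
Proof.
move=> mg mE EP; apply/cond_prob_given_cstP => B mB.
have mgX i : measurable ((g \o X) @^-1` [set i]).
  by rewrite comp_preimage; exact: measurable_preimage (mg i).
have mXB := measurable_preimage mB.
have mEg : measurable [set w | E (g (X w)) w].
  have -> : [set w | E (g (X w)) w] =
      \bigcup_(i in [set: I]) (E i `&` (g \o X) @^-1` [set i]).
    apply/seteqP; split=> [w Ew|w [i _ [Ew /= gw]]]; last by rewrite gw.
    by exists (g (X w)).
  by apply: fin_bigcup_measurable => // i _; exact: measurableI.
rewrite (measure_fin_partition P mgX (measurableI _ _ mEg mXB)).
rewrite (measure_fin_partition P mgX mXB).
rewrite ge0_sume_distrr//.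
apply: eq_bigr => i _.
(* Since the choice depends on [X] alone, the event that it equals [i] can be absorbed into the test
   set, where [E i] is a fixed event. *)
have /cond_prob_given_cstP/(_ (B `&` g @^-1` [set i])) := EP i.
rewrite preimage_setI -comp_preimage => <-; last exact: measurableI.
congr (P _); apply/seteqP; split=> [w [[/= Ew Xw] gw]|w [Ew [Xw gw]]].
  by move: Ew; rewrite gw => Ew; split.
by split=> //; split=> //=; move: gw => /= ->.
Qed.

End ConditionalProbability.

Section Execution.
Context {R : realType} {d dV dW : measure_display}.
Context {Om : measurableType d} {P : probability Om R}.
Context {V : measurableType dV} {W : measurableType dW}.
Context {slot loc : finType} {class : eqType} {Op : Type}.
Variable X : execution P V W slot loc class Op.

Lemma measurable_server_info : measurable_fun setT (server_info X).
Proof. by apply: measurable_fun_pair; [exact: view_meas|exact: leakage_meas]. Qed.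

Lemma measurable_placement_verifier (s : slot) :
  measurable [set w | is_verifier X (placement X w s)].
Proof.
have -> : [set w | is_verifier X (placement X w s)] =
    \bigcup_(l in [set l | is_verifier X l]) [set w | placement X w s = l].
  apply/seteqP; split=> [w vw|w [l vl /= ->]//].
  by exists (placement X w s).
by apply: fin_bigcup_measurable => // l _; exact: placement_meas.
Qed.

Lemma measurable_target_view (A : attack X) (s : slot) :
  measurable ((target A \o view X) @^-1` [set s]).
Proof.
rewrite comp_preimage -[_ @^-1` _]setTI.
by apply: view_meas => //; exact: target_meas.
Qed.

Lemma measurable_hits_verifier (A : attack X) : measurable (hits_verifier A).
Proof.
(* The attacked slot is random, so the event is cut according to its value. *)
have -> : hits_verifier A = \bigcup_(s in [set: slot])
    ([set w | is_verifier X (placement X w s)] `&`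
     (target A \o view X) @^-1` [set s]).
  apply/seteqP; split=> [w Aw|w [s _ [vw /= tw]]].
    by exists (target A (view X w)).
  by rewrite /hits_verifier /= tw.
apply: fin_bigcup_measurable => // s _; apply: measurableI.
  exact: measurable_placement_verifier.
exact: measurable_target_view.
Qed.

(** Keeping [q] arbitrary lets the bound serve both the class ratio [q_v] and the explicit uniform
    ratio. *)
Lemma p_nd_le (A : attack X) (t : class) (delta q : R) :
  0 <= delta -> attacks_class A t -> verifier_hits_detected X t delta ->
  cond_prob_given P (server_info X) (hits_verifier A) (cst q) ->
  p_nd A <= 1 - delta * q.
Proof.
move=> delta0 At Xdelta /(cond_prob_given_cstT measurable_server_info) PA.
have mD : measurable (detected A) := attack_rejects_meas A.
have mH := measurable_hits_verifier A.
have mDH : measurable (detected A `&` hits_verifier A) by exact: measurableI.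
rewrite /p_nd probability_setC// fineB ?fin_num_measure//=.
rewrite lerD2l lerN2.
(* The intermediate quantity is the numerator of the conditional detection probability. *)
apply: (@le_trans _ _ (fine (P (detected A `&` hits_verifier A)))); last first.
  apply: fine_le; rewrite ?fin_num_measure//.
  by apply: le_measure; rewrite ?inE//; exact: subIsetl.
(* [verifier_hits_detected] only speaks of hits of positive probability; for [q = 0] the bound
   reduces to nonnegativity. *)
have [H0|q_neq0] := eqVneq q 0.
  by rewrite H0 mulr0 fine_ge0.
have q0 : 0 < q by rewrite lt_neqAle eq_sym q_neq0 -lee_fin -PA measure_ge0.
have := Xdelta A At; rewrite PA lte_fin => /(_ q0).
by rewrite /cond_prob PA/= ler_pdivlMr.
Qed.

Lemma card_slot : #|slot| = (n_data X + n_verifier X)%N.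
Proof.
have [w _] := probability_nonempty P.
rewrite (bij_eq_card (placement_bij X w)) /n_data /n_verifier !cardsE addnC.
by rewrite -(cardC (is_verifier X)).
Qed.

Lemma L_v_homogeneous (t : class) :
  (forall s, slot_class X s = t) -> L_v X t = n_verifier X.
Proof.
move=> Xt; have [w _] := probability_nonempty P.
rewrite -(L_vE X w) /n_verifier.
(* With a single class, the verifier slots are the preimage of the verifier locations under the
   bijective placement. *)
rewrite -(on_card_preimset (onW_bij _ (placement_bij X w))).
by apply: eq_card => s; rewrite !inE Xt eqxx.
Qed.

Lemma q_v_homogeneous (t : class) : (forall s, slot_class X s = t) ->
  q_v X t = (n_verifier X)%:R / (n_data X + n_verifier X)%:R.
Proof.
move=> Xt; rewrite /q_v L_v_homogeneous// -card_slot /L_tot.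
by congr (_ / _%:R); apply: eq_card => s; rewrite !inE Xt eqxx.
Qed.

Lemma hits_verifier_uniform (A : attack X) : uniform_placement X ->
  cond_prob_given P (server_info X) (hits_verifier A)
    (cst ((n_verifier X)%:R / (n_data X + n_verifier X)%:R)).
Proof.
move=> Xunif.
(* The target is read as a function of [server_info] through its first component, the view. *)
apply: (@cond_prob_given_at_choice _ _ _ _ _ P _ measurable_server_info _
  (fun vw => target A vw.1)
  (fun s => [set w | is_verifier X (placement X w s)])) => s.
- rewrite [_ @^-1` _](_ : _ = fst @^-1` (target A @^-1` [set s]))//.
  rewrite -[_ @^-1` _]setTI.
  by apply: measurable_fst => //; exact: target_meas.
- exact: measurable_placement_verifier.
- rewrite {1}/n_verifier cardsE.
  apply: (@cond_prob_given_fin_uniform _ _ _ _ _ P _ measurable_server_info _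
    (fun w => placement X w s) _ (is_verifier X)) => l.
    exact: placement_meas.
  exact: (Xunif s l).
Qed.

End Execution.

Theorem proposition6p2 (R : realType) (d dV dW : measure_display)
    (Om : measurableType d) (P : probability Om R)
    (V : measurableType dV) (W : measurableType dW)
    (slot loc : finType) (class : eqType) (Op : Type)
    (X : execution P V W slot loc class Op) :
  (forall (t : class) (A : attack X) (delta : R),
     0 <= delta <= 1 ->
     (0 < L_tot X t)%N ->
     attacks_class A t ->
     cond_prob_given P (server_info X) (hits_verifier A) (cst (q_v X t)) ->
     verifier_hits_detected X t delta ->
     p_nd A <= 1 - delta * q_v X t)
  /\
  (forall (t : class) (A : attack X) (delta : R),
     0 <= delta <= 1 ->
     (0 < n_data X + n_verifier X)%N ->
     (forall s, slot_class X s = t) ->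
     uniform_placement X ->
     verifier_hits_detected X t delta ->
     [/\ q_v X t = (n_verifier X)%:R / (n_data X + n_verifier X)%:R,
         cond_prob_given P (server_info X) (hits_verifier A)
           (cst ((n_verifier X)%:R / (n_data X + n_verifier X)%:R))
       & p_nd A <= 1 - delta * ((n_verifier X)%:R / (n_data X + n_verifier X)%:R)]).
Proof.
split=> t A delta /andP[delta0 _].
  by move=> _ At Aq Xdelta; exact: p_nd_le Xdelta Aq.
move=> _ Xt Xunif Xdelta; have Aq := hits_verifier_uniform A Xunif.
split=> //; first exact: q_v_homogeneous.
(* As all slots have class [t], every attack is an attack on class [t]. *)
by apply: p_nd_le Xdelta Aq => // v; exact: Xt.
Qed.
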